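(* Let $\mathrm{sp}(6,\mathbb{F}_2)$ be the graph whose vertices are the $63$ non-zero vectors of $\mathbb{F}_2^6$, with distinct vertices $u,v$ joined by an edge if and only if $\sigma(u,v)=0$, where $\sigma(u,v)=u^{T}\begin{pmatrix}0&I_3\\-I_3&0\end{pmatrix}v$ is the canonical symplectic form over $\mathbb{F}_2$. Then $$C_0\big(\mathrm{sp}(6,\mathbb{F}_2)\big)=\log 7\qquad\text{while}\qquad C_0^{\mathrm{E}}\big(\mathrm{sp}(6,\mathbb{F}_2)\big)=\log 9 .$$
   Context: Channels. A (discrete memoryless) classical channel $\mathcal{N}$ has finite input alphabet $X$, finite output alphabet $Y$, and conditional probabilities $\mathcal{N}(y|x)$. $\mathcal{N}^{\otimes n}$ denotes $n$ independent uses of $\mathcal{N}$: inputs $X^n$, outputs $Y^n$, probabilities $\prod_j\mathcal{N}(y_j|x_j)$. Confusability graph. Distinct inputs $x_1,x_2$ are confusable if some $y$ has $\mathcal{N}(y|x_1)>0$ and $\mathcal{N}(y|x_2)>0$. The confusability graph $G(\mathcal{N})$ is the simple graph on $X$ whose edges are the confusable pairs. Unassisted zero-error capacity. $M_0(\mathcal{N})$ is the maximum number of messages that can be sent with a single use of $\mathcal{N}$ with zero probability of decoding error; it equals the independence number $\alpha(G(\mathcal{N}))$. $C_0(\mathcal{N}):=\lim_{n\to\infty}\frac1n\log M_0(\mathcal{N}^{\otimes n})$. Equivalently, for a graph $G$, $C_0(G)=\log\Theta(G)$ with $\Theta(G)=\lim_{n}\sqrt[n]{\alpha(G^{\boxtimes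 n})}$. Here $G^{\boxtimes n}$ is the strong power: its vertices are $V(G)^n$, and distinct $n$-tuples $a,b$ are adjacent if and only if for each $j$ either $a_j=b_j$ or $a_jb_j\in E(G)$. Entanglement-assisted zero-error capacity. $M_0^{\mathrm{E}}(\mathcal{N})$ is the largest integer $q$ for which the following exist: finite-dimensional complex Hilbert spaces $H_A,H_B$; a density operator $\rho$ on $H_A\otimes H_B$; for each message $m\in\{1,\dots,q\}$ a POVM $\{A^{m}_x\}_{x\in X}$ on $H_A$; and for each $y\in Y$ a POVM $\{B^{y}_{m'}\}_{m'=1}^q$ on $H_B$; such that $\sum_{x,y}\mathcal{N}(y|x)\operatorname{Tr}[\rho\,(A^m_x\otimes B^y_{m'})]=0$ whenever $m\neq m'$. $C_0^{\mathrm{E}}(\mathcal{N}):=\lim_{n\to\infty}\frac1n\log M_0^{\mathrm{E}}(\mathcal{N}^{\otimes n})$. Both $M_0,C_0$ and $M_0^{\mathrm{E}},C_0^{\mathrm{E}}$ depend only on the confusability graph of the channel. For a graph $G$, $C_0(G)$ and $C_0^{\mathrm{E}}(G)$ denote the values for any channel whose confusability graph is $G$. Logarithms are to an arbitrary fixed base. *)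

(* Defs.v *)
From HB Require Import structures.
From mathcomp Require Import all_boot all_order all_algebra.
From mathcomp Require Import complex mxtens.
From mathcomp Require Import all_classical all_reals all_analysis.
Import numFieldNormedType.Exports.
Import Order.TTheory GRing.Theory Num.Theory.

Set Implicit Arguments.
Unset Strict Implicit.
Unset Printing Implicit Defensive.

Local Open Scope complex_scope.
Local Open Scope classical_set_scope.
Local Open Scope ring_scope.

Record sgraph := SGraph {
  vertex :> finType;
  edge : rel vertex;
  edge_sym : symmetric edge;
  edge_irr : irreflexive edge
}.

(* [N x y] is the conditional probability N(y|x). *)
Record channel (R : realType) (X Y : finType) := Channel {
  chan_prob :> X -> Y -> R;
  chan_ge0 : forall x y, 0 <= chan_prob x y;
  chan_sum1 : forall x, \sum_y chan_prob x y = 1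
}.

Section ChannelPower.
Variables (R : realType) (X Y : finType) (N : channel R X Y) (n : nat).

Definition chan_pow_prob (x : {ffun 'I_n -> X}) (y : {ffun 'I_n -> Y}) : R :=
  \prod_(j < n) N (x j) (y j).

Lemma chan_pow_ge0 x y : 0 <= chan_pow_prob x y.
Proof. by apply: prodr_ge0 => j _; apply: chan_ge0. Qed.

Lemma chan_pow_sum1 x : \sum_y chan_pow_prob x y = 1.
Proof.
rewrite /chan_pow_prob -(bigA_distr_bigA (fun j y => N (x j) y)) /=.
by rewrite big1 // => j _; apply: chan_sum1.
Qed.

Definition chan_pow : channel R {ffun 'I_n -> X} {ffun 'I_n -> Y} :=
  Channel chan_pow_ge0 chan_pow_sum1.

End ChannelPower.

Definition confusable (R : realType) (X Y : finType) (N : channel R X Y) :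
    rel X :=
  [rel x1 x2 | (x1 != x2) && [exists y, (0 < N x1 y) && (0 < N x2 y)]].

Section Confusability.
Variables (R : realType) (X Y : finType) (N : channel R X Y).

Lemma confusable_sym : symmetric (confusable N).
Proof.
move=> x1 x2; rewrite /confusable /= eq_sym; congr andb.
by apply: eq_existsb => y; rewrite andbC.
Qed.

Lemma confusable_irr : irreflexive (confusable N).
Proof. by move=> x; rewrite /confusable /= eqxx. Qed.

Definition confusability_graph : sgraph :=
  SGraph confusable_sym confusable_irr.

End Confusability.

Definition is_largest (P : nat -> Prop) (q : nat) : Prop :=
  P q /\ forall q', P q' -> (q' <= q)%N.

Definition zero_error_code (R : realType) (X Y : finType) (N : channel R X Y)
    (q : nat) : Prop :=
  exists (enc : 'I_q -> X) (dec : Y -> 'I_q),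
    forall m, \sum_(y | dec y != m) N (enc m) y = 0.

(* Positive semidefiniteness: since [0 <= z] in [R[i]] entails that [z] is
   real, the condition forces [A] to be Hermitian. *)
Definition psd (R : realType) (d : nat) (A : 'M[R[i]]_d) : Prop :=
  forall v : 'cV[R[i]]_d, 0 <= (map_mx Num.conj v^T *m A *m v) 0 0.

Definition density (R : realType) (d : nat) (rho : 'M[R[i]]_d) : Prop :=
  psd rho /\ \tr rho = 1.

Definition povm (R : realType) (d : nat) (I : finType) (E : I -> 'M[R[i]]_d) :
    Prop :=
  (forall i, psd (E i)) /\ \sum_i E i = 1%:M.

(* The Hilbert spaces are C^dA and C^dB; [*t] is the Kronecker product. *)
Definition ent_zero_error_code (R : realType) (X Y : finType)
    (N : channel R X Y) (q : nat) : Prop :=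
  exists (dA dB : nat) (rho : 'M[R[i]]_(dA * dB))
         (A : 'I_q -> X -> 'M[R[i]]_dA) (B : Y -> 'I_q -> 'M[R[i]]_dB),
    [/\ density rho,
        forall m, povm (A m),
        forall y, povm (B y) &
        forall m m' : 'I_q, m != m' ->
          \sum_x \sum_y (N x y)%:C * \tr (rho *m (A m x *t B y m')) = 0].

Definition logb (R : realType) (b x : R) : R := ln x / ln b.

(* [is_C0 b N c]: the limit of (1/n) log_b M_0(N^{(x)n}) exists and is [c],
   where [M n] is the (unique) value of M_0(N^{(x)n}); similarly [is_C0E]. *)
Definition is_C0 (R : realType) (b : R) (X Y : finType) (N : channel R X Y)
    (c : R) : Prop :=
  exists M : nat -> nat,
    (forall n, is_largest (zero_error_code (chan_pow N n)) (M n)) /\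
    (n%:R^-1 * logb b (M n)%:R @[n --> \oo] --> c).

Definition is_C0E (R : realType) (b : R) (X Y : finType) (N : channel R X Y)
    (c : R) : Prop :=
  exists M : nat -> nat,
    (forall n, is_largest (ent_zero_error_code (chan_pow N n)) (M n)) /\
    (n%:R^-1 * logb b (M n)%:R @[n --> \oo] --> c).

(* The capacities of a graph are those of any channel having it as
   confusability graph; [sgraph_channel] below shows that there is one. *)
Definition is_graph_C0 (R : realType) (b : R) (G : sgraph) (c : R) : Prop :=
  forall (Y : finType) (N : channel R G Y),
    edge (s := confusability_graph N) =2 edge (s := G) -> is_C0 b N c.

Definition is_graph_C0E (R : realType) (b : R) (G : sgraph) (c : R) : Prop :=
  forall (Y : finType) (N : channel R G Y),
    edge (s := confusability_graph N) =2 edge (s := G) -> is_C0E b N c.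

Lemma sgraph_channel (R : realType) (G : sgraph) :
  exists (Y : finType) (N : channel R G Y),
    edge (s := confusability_graph N) =2 edge (s := G).
Proof.
pose inc (x : G) (e : G * G) :=
  ((x == e.1) || (x == e.2)) && ((e.1 == e.2) || edge e.1 e.2).
pose k x := \sum_e (inc x e)%:R : R.
have k0 x : 0 < k x.
  rewrite /k (bigD1 (x, x)) //= /inc !eqxx /=.
  by rewrite ltr_pwDl ?ltr01 // sumr_ge0.
have ge0 x e : 0 <= (inc x e)%:R / k x by rewrite divr_ge0 // ltW.
have sum1 x : \sum_e (inc x e)%:R / k x = 1.
  by rewrite -mulr_suml -/(k x) divff // lt0r_neq0.
exists (G * G)%type, (Channel ge0 sum1) => x1 x2 /=.
have pos x e : (0 < (inc x e)%:R / k x) = inc x e.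
  by rewrite pmulr_lgt0 ?invr_gt0 // ltr0n lt0b.
apply/andP/idP => [[ne /existsP[[a c]]]|x12].
  rewrite !pos /inc /= => /andP[/andP[/orP[]/eqP h1 he] /andP[/orP[]/eqP h2 _]];
    move: ne he; rewrite h1 h2 ?eqxx //.
  - by move=> /negPf -> /=.
  - by rewrite eq_sym edge_sym => /negPf -> /=.
split; first by apply/eqP => e12; rewrite e12 edge_irr in x12.
by apply/existsP; exists (x1, x2); rewrite !pos /inc /= !eqxx x12 !orbT.
Qed.

Section SymplecticGraph.

Definition symp_mx : 'M['F_2]_(3 + 3) := block_mx 0 1%:M (- 1%:M) 0.

Definition sigma (u v : 'cV['F_2]_(3 + 3)) : 'F_2 :=
  (u^T *m symp_mx *m v) 0 0.

Definition sp6_vertex : finType := {v : 'cV['F_2]_(3 + 3) | v != 0}.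

Definition sp6_edge : rel sp6_vertex :=
  [rel u v | (u != v) && (sigma (val u) (val v) == 0)].

Lemma sp6_edge_sym : symmetric sp6_edge.
Proof.
move=> u v; rewrite /sp6_edge /= eq_sym; congr andb.
have sigmaN (x y : 'cV_(3 + 3)) : sigma x y = - sigma y x.
  have -> : sigma x y = (x^T *m symp_mx *m y)^T 0 0 by rewrite mxE.
  rewrite !trmx_mul trmxK /symp_mx tr_block_mx !trmx0 linearN /= !trmx1.
  rewrite -[in LHS](opprK (block_mx _ _ _ _)) opp_block_mx !oppr0 opprK.
  by rewrite mulmxA mulmxN mulNmx mxE.
by rewrite sigmaN oppr_eq0.
Qed.

Lemma sp6_edge_irr : irreflexive sp6_edge.
Proof. by move=> u; rewrite /sp6_edge /= eqxx. Qed.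

Definition sp6 : sgraph := SGraph sp6_edge_sym sp6_edge_irr.

End SymplecticGraph.

(* Main.v *)
(* The 63 nonzero vectors of F_2^6 split into nine isotropic 7-sets (a symplectic spread),
   and correspond to the 63 roots of E7 up to sign in such a way that the symplectic
   form is half the inner product modulo 2, so that adjacent means orthogonal and
   the nine cliques become orthogonal frames of R^7.

   Classical capacity: seven vectors are pairwise non-orthogonal for sigma, and
   the matrix 1 + sigma(u, v) over F_2 has rank at most 7 (Haemers' bound).

   Entanglement: with a maximally entangled pair, message k is encoded by measuring
   in the k-th frame; a channel output leaves a clique, hence an orthonormal set,
   of possible inputs, which Bob can tell apart.  Conversely 9 is an upper bound
   because of the nine cliques covering the graph.  Given a clique, let
   a_m be the effect that Alice, sending m, inputs a vertex of it, and omega her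
   reduced state.  Zero error forces omega(a_m a_m') = 0 for m <> m', and then
   0 <= omega((sum_m a_m - 1)^2) <= 1 - sum_m omega(a_m).  Summing over the cliques
   bounds the number of messages by the number of cliques.  Both codes and both
   bounds are multiplicative. *)
From HB Require Import structures.
Require Import Defs.
From mathcomp Require Import all_boot all_order all_algebra.
From mathcomp Require Import complex mxtens spectral.
From mathcomp Require Import all_classical all_reals all_analysis.
Import numFieldNormedType.Exports.
Import Order.TTheory GRing.Theory Num.Theory.

Set Implicit Arguments.
Unset Strict Implicit.
Unset Printing Implicit Defensive.

Local Open Scope classical_set_scope.
Local Open Scope complex_scope.
Local Open Scope sesquilinear_scope.
Local Open Scope ring_scope.

(** * Positive semidefinite matrices *)

Section PositiveSemidefinite.
Variable R : realType.
Local Notation C := R[i].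

Lemma trmxC_mul m n p (A : 'M[C]_(m, n)) (B : 'M[C]_(n, p)) :
  (A *m B)^t* = B^t* *m A^t*.
Proof. by rewrite trmx_mul map_mxM. Qed.

Lemma gram_entry m n (S : 'M[C]_(m, n)) i :
  (S^t* *m S) i i = \sum_j `|S j i| ^+ 2.
Proof.
by rewrite mxE; apply: eq_bigr => j _; rewrite !mxE mulrC normCK.
Qed.

Lemma psd_gram m n (S : 'M[C]_(m, n)) : psd (S^t* *m S).
Proof.
move=> v; rewrite mulmxA -trmxC_mul -mulmxA gram_entry.
by apply: sumr_ge0 => j _; rewrite exprn_ge0.
Qed.

(** Complex polarization: once the diagonal vanishes, the form at [u i + c *: u j] is c B_ij + c^*
    B_ji, and the choices [1] and ['i] of [c] force B_ij = 0. *)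
Lemma quadratic_form_eq0 n (B : 'M[C]_n) :
  (forall v : 'cV[C]_n, (v^t* *m B *m v) 0 0 = 0) -> B = 0.
Proof.
move=> B0; apply/matrixP => i j; rewrite mxE.
pose u k : 'cV[C]_n := delta_mx k 0.
have Buu k l : (u k)^t* *m B *m u l = (B k l)%:M.
  by apply/matrixP => a b; rewrite !ord1 /u trmx_delta map_delta_mx -rowE -colE !mxE.
have diag0 k : B k k = 0 by have := B0 (u k); rewrite Buu mxE.
have sq0 c : c * B i j + c^* * B j i = 0.
  have := B0 (u i + c *: u j).
  have -> : (u i + c *: u j)^t* = (u i)^t* + c^* *: (u j)^t*.
    by apply/matrixP => a b; rewrite !mxE rmorphD rmorphM.
  rewrite !mulmxDl !mulmxDr -!scalemxAl.
  by rewrite -!scalemxAr !Buu !mxE !diag0 !mulr0 addr0 add0r.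
have := sq0 1; rewrite conjC1 !mul1r => /eqP; rewrite addr_eq0 => /eqP Bij.
have /eqP := sq0 'i; rewrite conjCi Bij mulrN mulNr -opprD oppr_eq0.
rewrite -mulr2n mulrn_eq0 /= mulf_eq0 (negPf (neq0Ci _)) /= => /eqP ->.
by rewrite oppr0.
Qed.

(** Spectral theorem, with square roots of the eigenvalues. Tensor products, congruences and trace
    inequalities for [psd] matrices are all read off this factorization. *)
Lemma psd_factor n (A : 'M[C]_n) : psd A -> exists S : 'M[C]_n, A = S^t* *m S.
Proof.
move=> psdA.
(* Positivity makes every value of the form of [A] real, so the form of [A^t* - A] vanishes
   identically. *)
have herm : A^t* = A.
  apply/eqP; rewrite -subr_eq0; apply/eqP/quadratic_form_eq0 => v.
  rewrite mulmxBr mulmxBl.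
  have -> : v^t* *m A^t* *m v = (v^t* *m A *m v)^t*.
    by rewrite !trmxC_mul trmxCK mulmxA.
  by have := psdA v; move: (v^t* *m A *m v) => q q0; rewrite !mxE geC0_conj ?subrr.
have normA : A \is normalmx by apply/normalmxP; rewrite herm.
have [P0 A0] := (spectral_unitarymx A, orthomx_spectralP normA).
set P := spectralmx A in P0 A0; set sp := spectral_diag A in A0.
have Pi : invmx P = P^t* by rewrite invmx_unitary.
(* The eigenvalue [sp 0 i] is the value of the form at the adjoint of row [i] of [P]. *)
have sp_ge0 i : 0 <= sp 0 i.
  have PPi : P *m P^t* = 1%:M by apply/unitarymxP.
  have DE : P *m A *m P^t* = diag_mx sp.
    by rewrite A0 Pi !mulmxA PPi mul1mx -mulmxA PPi mulmx1.
  have := psdA ((row i P)^t*); rewrite trmxCK.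
  have -> : (row i P)^t* = col i (P^t*) by apply/matrixP => a b; rewrite !mxE.
  by rewrite -row_mul colE mulmxA -row_mul -colE DE !mxE eqxx mulr1n.
exists (diag_mx (map_mx sqrtC sp) *m P).
rewrite {1}A0 Pi trmxC_mul -!mulmxA; congr (_ *m _).
rewrite mulmxA tr_diag_mx map_diag_mx mulmx_diag; congr (diag_mx _ *m _).
apply/rowP => i; rewrite !mxE -[RHS]/((sqrtC (sp 0 i))^* * sqrtC (sp 0 i)) geC0_conj;
  last by rewrite sqrtC_ge0.
by rewrite -expr2 sqrtCK.
Qed.

Lemma psd_tens m n (A : 'M[C]_m) (B : 'M[C]_n) : psd A -> psd B -> psd (A *t B).
Proof.
move=> /psd_factor[S ->] /psd_factor[T ->].
suff -> : S^t* *m S *t (T^t* *m T) = (S *t T)^t* *m (S *t T) by apply: psd_gram.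
by rewrite trmx_tens map_mxT tensmx_mul.
Qed.

Lemma psd1 n : psd (1%:M : 'M[C]_n).
Proof.
suff -> : 1%:M = 1%:M^t* *m 1%:M :> 'M[C]_n by apply: psd_gram.
by rewrite trmx1 map_mx1 mulmx1.
Qed.

Lemma psd_sum n (I : finType) (P : pred I) (F : I -> 'M[C]_n) :
  (forall i, P i -> psd (F i)) -> psd (\sum_(i | P i) F i).
Proof.
move=> F0 v; rewrite mulmx_sumr mulmx_suml summxE.
by apply: sumr_ge0 => i /F0.
Qed.

Lemma psd_congr m n (A : 'M[C]_n) (S : 'M[C]_(n, m)) :
  psd A -> psd (S^t* *m A *m S).
Proof.
by move=> /psd_factor[T ->]; rewrite mulmxA -trmxC_mul -mulmxA; apply: psd_gram.
Qed.

Lemma psd_herm n (A : 'M[C]_n) : psd A -> A^t* = A.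
Proof. by move=> /psd_factor[T ->]; rewrite trmxC_mul trmxCK. Qed.

Lemma trace_gram_ge0 m n (S : 'M[C]_(m, n)) : 0 <= \tr (S^t* *m S).
Proof.
by apply: sumr_ge0 => i _; rewrite gram_entry sumr_ge0 // => j _; rewrite exprn_ge0.
Qed.

Lemma trace_gram_eq0 m n (S : 'M[C]_(m, n)) : \tr (S^t* *m S) = 0 -> S = 0.
Proof.
rewrite /mxtrace => /eqP; rewrite psumr_eq0; last first.
  by move=> i _; rewrite gram_entry sumr_ge0 // => j _; rewrite exprn_ge0.
move=> /allP S0; apply/matrixP => j i; rewrite mxE.
have /implyP/(_ isT) := S0 i (mem_index_enum _).
rewrite gram_entry psumr_eq0; last by move=> k _; rewrite exprn_ge0.
by move=> /allP/(_ j (mem_index_enum _)); rewrite expf_eq0 /= normr_eq0 => /eqP.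
Qed.

Lemma trace_gram_mul m n p (S : 'M[C]_(m, n)) (T : 'M[C]_(p, n)) :
  \tr (S^t* *m S *m (T^t* *m T)) = \tr ((S *m T^t*)^t* *m (S *m T^t*)).
Proof. by rewrite trmxC_mul trmxCK mulmxA mxtrace_mulC !mulmxA. Qed.

Lemma psd_trace_mul_ge0 n (A B : 'M[C]_n) : psd A -> psd B -> 0 <= \tr (A *m B).
Proof.
move=> /psd_factor[S ->] /psd_factor[T ->].
by rewrite trace_gram_mul trace_gram_ge0.
Qed.

(** For Gram factors S and T the trace is the squared Hilbert-Schmidt norm of [S *m T^t*], which
    occurs inside the product. This upgrades vanishing probabilities to matrix identities. *)
Lemma psd_trace_mul_eq0 n (A B : 'M[C]_n) :
  psd A -> psd B -> \tr (A *m B) = 0 -> A *m B = 0.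
Proof.
move=> /psd_factor[S ->] /psd_factor[T ->].
rewrite trace_gram_mul => /trace_gram_eq0 ST0.
by rewrite mulmxA -(mulmxA _ S) ST0 mulmx0 mul0mx.
Qed.

End PositiveSemidefinite.

(** * Entanglement-assisted codes and clique covers *)

Section TensorLinearity.
Variables (K : comPzRingType) (m n p q : nat).

Lemma tensmx_sumr (I : finType) (P : pred I) (F : I -> 'M[K]_(p, q))
    (A : 'M[K]_(m, n)) :
  A *t (\sum_(i | P i) F i) = \sum_(i | P i) A *t F i.
Proof.
apply/matrixP => i j; rewrite !mxE !summxE mulr_sumr.
by apply: eq_bigr => k _; rewrite !mxE.
Qed.

End TensorLinearity.

Lemma tensmx11 (K : comPzRingType) (m n : nat) :
  1%:M *t 1%:M = 1%:M :> 'M[K]_(m * n).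
Proof.
apply/matrixP => i j.
case: (mxtens_indexP i) => i0 i1; case: (mxtens_indexP j) => j0 j1.
by rewrite tensmxE !mxE (can_eq (@mxtens_indexK _ _)) xpair_eqE -natrM mulnb.
Qed.

(** Unlike [confusable], this also holds between equal inputs, so that on powers it becomes a plain
    coordinatewise conjunction. *)
Definition overlap (R : realType) (X Y : finType) (N : channel R X Y) : rel X :=
  [rel x x' | [exists y, (0 < N x y) && (0 < N x' y)]].

Section EntanglementBound.
Variable R : realType.
Local Notation C := R[i].

(** Under [omega] the cross terms of the square of [c] vanish and each effect dominates its square,
    so [omega (c *m c) <= omega c]; positivity at the square of [c - 1] then gives the bound. *)
Lemma sum_nonoverlapping_effects_le1 (d : nat) (omega : {linear 'M[C]_d -> C^o})
    (I : finType) (a : I -> 'M[C]_d) :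
  (forall M, psd M -> 0 <= omega M) -> omega 1%:M = 1 ->
  (forall i, psd (a i)) -> (forall i, psd (1%:M - a i)) ->
  (forall i j, i != j -> omega (a i *m a j) = 0) ->
  \sum_i omega (a i) <= 1.
Proof.
move=> omega_ge0 omega1 a_ge0 a_le1 a_orth; set c := \sum_i a i.
have sq_le i : omega (a i *m a i) <= omega (a i).
  rewrite -subr_ge0 -linearB; apply: omega_ge0.
  (* [a - a^2 = a (1 - a) a + (1 - a) a (1 - a)]. *)
  have -> : a i - a i *m a i =
      (a i)^t* *m (1%:M - a i) *m a i + (1%:M - a i)^t* *m a i *m (1%:M - a i).
    rewrite !psd_herm // !mulmxBl !mulmxBr !mulmxBl !mul1mx !mulmx1.
    by rewrite [RHS]addrC subrK.
  by move=> v; rewrite mulmxDr mulmxDl mxE addr_ge0 //; apply: psd_congr.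
have cc : omega (c *m c) <= omega c.
  rewrite {1 2}/c mulmx_suml linear_sum linear_sum ler_sum // => i _.
  rewrite mulmx_sumr linear_sum (bigD1 i) //= big1 ?addr0 // => j.
  by rewrite eq_sym => /a_orth.
have c_herm : c^t* = c by apply: psd_herm; apply: psd_sum.
have : 0 <= omega ((c - 1%:M)^t* *m (c - 1%:M)) by apply/omega_ge0/psd_gram.
have -> : (c - 1%:M)^t* = c - 1%:M.
  by rewrite -[in RHS]c_herm; apply/matrixP => i j;
    rewrite !mxE rmorphB rmorph_nat eq_sym.
rewrite mulmxBl !mulmxBr !mulmx1 mul1mx !linearB /= omega1 opprK => h.
rewrite -linear_sum -/c -subr_ge0 addrC; apply: le_trans h _.
by rewrite gerDr subr_le0.
Qed.

Lemma ent_code_le_clique_cover (X Y K : finType) (N : channel R X Y)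
    (kappa : X -> K) (q : nat) :
  (forall x x', kappa x = kappa x' -> overlap N x x') ->
  ent_zero_error_code N q -> (q <= #|K|)%N.
Proof.
move=> cliq [dA [dB [rho [A [B [[rho_ge0 rho1] povmA povmB err]]]]]].
have term_ge0 x y m m' : 0 <= (N x y)%:C * \tr (rho *m (A m x *t B y m')).
  rewrite mulr_ge0 ?ler0c ?chan_ge0 // psd_trace_mul_ge0 //.
  by apply: psd_tens; [apply: (povmA m).1 | apply: (povmB y).1].
have tr0 m m' x y : m != m' -> 0 < N x y -> \tr (rho *m (A m x *t B y m')) = 0.
  move=> /err /eqP; rewrite psumr_eq0; last first.
    by move=> x' _; apply: sumr_ge0.
  move=> /allP/(_ x (mem_index_enum _))/implyP/(_ isT).
  rewrite psumr_eq0 // => /allP/(_ y (mem_index_enum _))/implyP/(_ isT).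
  by rewrite mulf_eq0 => /orP[/eqP[->]|/eqP //]; rewrite ltxx.
have psdAB m m' x y : psd (A m x *t B y m').
  by apply: psd_tens; [apply: (povmA m).1 | apply: (povmB y).1].
have rho0 m m' x y : m != m' -> 0 < N x y -> rho *m (A m x *t B y m') = 0.
  by move=> mm' Nxy; apply: psd_trace_mul_eq0 => //; apply: tr0.
have rho0' m m' x y : m != m' -> 0 < N x y -> (A m x *t B y m') *m rho = 0.
  move=> mm' Nxy; apply: psd_trace_mul_eq0 => //.
  by rewrite mxtrace_mulC; apply: tr0.
pose omega M : C^o := \tr (rho *m (M *t (1%:M : 'M[C]_dB))).
have omega_lin : linear omega.
  move=> k M M'; rewrite /omega.
  have -> : (k *: M + M') *t (1%:M : 'M[C]_dB) = k *: (M *t 1%:M) + M' *t 1%:M.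
    by apply/matrixP => i j; rewrite !mxE mulrDl mulrA.
  by rewrite mulmxDr -scalemxAr linearD linearZ.
pose omegaL : {linear 'M[C]_dA -> C^o} :=
  HB.pack omega (GRing.isLinear.Build _ _ _ _ _ omega_lin).
have omega_ge0 M : psd M -> 0 <= omegaL M.
  by move=> M_ge0; rewrite psd_trace_mul_ge0 //; apply: psd_tens => //; apply: psd1.
have omega1 : omegaL 1%:M = 1 by rewrite /= /omega tensmx11 mulmx1.
(* Insert the POVM of a common output [y]: each outcome [m''] is wrong for [m] or for [m'], and the
   wrong factor is brought next to [rho], on its left or its right, which kills the term. *)
have orth m m' x x' : m != m' -> overlap N x x' ->
    omega (A m x *m A m' x') = 0.
  move=> mm' /existsP[y /andP[Nxy Nx'y]].
  rewrite /omega -(povmB y).2 tensmx_sumr mulmx_sumr linear_sum big1 //= => m'' _.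
  have [mm''|mm''] := eqVneq m m''.
    have -> : (A m x *m A m' x') *t B y m'' =
        (A m x *t 1%:M) *m (A m' x' *t B y m'').
      by rewrite tensmx_mul mul1mx.
    by rewrite mxtrace_mulC -mulmxA rho0' ?mulmx0 ?mxtrace0 // -mm'' eq_sym.
  have -> : (A m x *m A m' x') *t B y m'' =
      (A m x *t B y m'') *m (A m' x' *t 1%:M).
    by rewrite tensmx_mul mulmx1.
  by rewrite mulmxA rho0 ?mul0mx ?mxtrace0.
pose a k m := \sum_(x | kappa x == k) A m x.
have a_ge0 k m : psd (a k m) by apply: psd_sum => x _; apply: (povmA m).1.
have sum_a m : \sum_k a k m = 1%:M.
  by rewrite -(povmA m).2 (partition_big kappa xpredT).
have a_le1 k m : psd (1%:M - a k m).
  rewrite -(sum_a m) (bigD1 k) //= addrAC subrr add0r.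
  by apply: psd_sum.
have cell k : \sum_m omegaL (a k m) <= 1.
  apply: sum_nonoverlapping_effects_le1 => // m m' mm'.
  rewrite mulmx_suml linear_sum big1 // => x /eqP kx.
  rewrite mulmx_sumr linear_sum big1 // => x' /eqP kx'.
  by apply: orth => //; apply: cliq; rewrite kx kx'.
(* Double counting: each clique carries weight at most 1, each message weight exactly 1. *)
have : \sum_k \sum_m omegaL (a k m) <= \sum_(k : K) 1 by apply: ler_sum.
rewrite exchange_big /= (eq_bigr (fun=> 1)); last first.
  by move=> m _; rewrite -(linear_sum omegaL) sum_a omega1.
by rewrite !sumr_const card_ord ler_nat.
Qed.

End EntanglementBound.

(** * Entanglement-assisted codes from families of orthonormal bases *)

Section EntangledCode.
Variable R : realType.
Local Notation C := R[i].

(** The unnormalized maximally entangled vector, as a row; the factor 1/d enters only in the density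
    matrix. *)
Definition max_ent d : 'rV[C]_(d * d) :=
  \row_k ((mxtens_unindex k).1 == (mxtens_unindex k).2)%:R.

(** The transpose trick: only the indices (i, i) survive. It is the reason why Alice's effects are
    transposed projectors in the code below. *)
Lemma max_ent_trace d (A B : 'M[C]_d) :
  \tr ((max_ent d)^t* *m max_ent d *m (A^T *t B)) = \tr (A *m B).
Proof.
rewrite -mulmxA mxtrace_mulC trace_mx11.
have sum_diag (F : 'I_(d * d) -> C) :
    \sum_k max_ent d 0 k * F k = \sum_i F (mxtens_index (i, i)).
  rewrite (reindex (@mxtens_index d d)) /=; last first.
    by exists (@mxtens_unindex d d) => ? _; rewrite ?mxtens_indexK ?mxtens_unindexK.
  rewrite (eq_bigr (fun p => max_ent d 0 (mxtens_index (p.1, p.2)) *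
    F (mxtens_index (p.1, p.2)))); last by case.
  rewrite -(pair_bigA _ (fun i j => max_ent d 0 (mxtens_index (i, j)) *
    F (mxtens_index (i, j)))) /=.
  apply: eq_bigr => i _; rewrite (bigD1 i) //= big1 ?addr0.
    by rewrite mxE mxtens_indexK eqxx mul1r.
  by move=> j ji; rewrite mxE mxtens_indexK eq_sym (negPf ji) mul0r.
rewrite mxE; under eq_bigr do rewrite mulrC.
have -> : \sum_i (max_ent d)^t* i 0 * (max_ent d *m (A^T *t B)) 0 i =
   \sum_i max_ent d 0 i * (max_ent d *m (A^T *t B)) 0 i.
  by apply: eq_bigr => i _; rewrite !mxE rmorph_nat.
rewrite sum_diag.
rewrite /mxtrace; apply: eq_bigr => i _; rewrite !mxE sum_diag.
by apply: eq_bigr => j _; rewrite tensmxE mxE.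
Qed.

Lemma ent_code_of_bases (X Y K : finType) (N : channel R X Y) (d : nat)
    (u : X -> 'cV[C]_d) (kappa : X -> K) (k0 : K) :
  (0 < d)%N ->
  (forall x, (u x)^t* *m u x = 1%:M) ->
  (forall x x', overlap N x x' -> x != x' -> (u x)^t* *m u x' = 0) ->
  (forall k, \sum_(x | kappa x == k) u x *m (u x)^t* = 1%:M) ->
  ent_zero_error_code N #|K|.
Proof.
move=> d_gt0 u1 u_orth u_complete.
have orth x x' y : 0 < N x y -> 0 < N x' y -> x != x' -> (u x)^t* *m u x' = 0.
  by move=> Nx Nx'; apply: u_orth; apply/existsP; exists y; rewrite Nx.
pose P x := u x *m (u x)^t*.
have P_ge0 x : psd (P x) by rewrite /P -[X in X *m _]trmxCK; apply: psd_gram.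
pose Q y k := \sum_(x | (kappa x == k) && (0 < N x y)) P x.
pose S y := \sum_(x | 0 < N x y) P x.
have S_sum y : S y = \sum_k Q y k.
  by rewrite /S (partition_big kappa xpredT) //=; apply: eq_bigr => k _;
    apply: eq_bigl => x; rewrite andbC.
(* The inputs compatible with [y] have pairwise orthogonal vectors, so [S y] is the projector on
   their span. *)
have Su x y : 0 < N x y -> S y *m u x = u x.
  move=> Nxy; rewrite mulmx_suml (bigD1 x) //= big1 ?addr0.
    by rewrite /P -mulmxA u1 mulmx1.
  by move=> x' /andP[Nx'y x'x]; rewrite /P -mulmxA (orth _ _ y) ?mulmx0.
have S_herm y : (S y)^t* = S y by apply/psd_herm/psd_sum.
have S_sq y : S y *m S y = S y.
  rewrite {2 3}/S mulmx_sumr; apply: eq_bigr => x Nxy.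
  by rewrite /P mulmxA Su.
have S_le1 y : psd (1%:M - S y).
  have -> : 1%:M - S y = (1%:M - S y)^t* *m (1%:M - S y).
    have -> : (1%:M - S y)^t* = 1%:M - S y.
      by rewrite -[in RHS]S_herm; apply/matrixP => i j;
        rewrite !mxE rmorphB rmorph_nat eq_sym.
    by rewrite mulmxBl mul1mx mulmxBr mulmx1 S_sq subrr subr0.
  exact: psd_gram.
pose rho := d%:R^-1 *: ((max_ent d)^t* *m max_ent d).
pose A (m : 'I_#|K|) x := (if kappa x == enum_val m then P x else 0)^T.
(* The projectors compatible with [y] need not sum to 1; the remainder goes to the arbitrary message
   [k0], harmlessly, since [1%:M - S y] kills every vector that can have led to [y]. *)
pose B y (m : 'I_#|K|) :=
  Q y (enum_val m) + (if enum_val m == k0 then 1%:M - S y else 0).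
exists d, d, rho, A, B; split.
- split.
    have d0 : (0 : C) <= d%:R^-1 by rewrite invr_ge0.
    move=> v; rewrite /rho -scalemxAr -scalemxAl mxE mulr_ge0 //.
    exact: psd_gram.
  rewrite /rho mxtraceZ -[_ *m _]mulmx1 -tensmx11 -[X in X *t _]trmx1.
  by rewrite max_ent_trace mulmx1 mxtrace1 mulVf // pnatr_eq0 -lt0n.
- move=> m; split.
    move=> x; rewrite /A; case: ifP => _; last first.
      by rewrite trmx0 => v; rewrite mulmx0 mul0mx mxE.
    have -> : (P x)^T = ((u x)^T)^t* *m (u x)^T.
      by rewrite /P trmx_mul; congr (_ *m _); apply/matrixP => i j; rewrite !mxE.
    exact: psd_gram.
  rewrite -trmx1 -(u_complete (enum_val m)) linear_sum [RHS]big_mkcond /=.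
  by apply: eq_bigr => x _; rewrite /A; case: ifP; rewrite ?trmx0.
- move=> y; split.
    move=> m v; rewrite mulmxDr mulmxDl mxE addr_ge0 //; first exact: psd_sum.
    by case: ifP => _; [apply: S_le1 | rewrite mulmx0 mul0mx mxE].
  rewrite /B -(big_enum_val (A := K)
    (fun k => Q y k + (if k == k0 then 1%:M - S y else 0))) /=.
  rewrite big_split /= -S_sum -big_mkcond big_pred1_eq.
  by rewrite addrC subrK.
move=> m m' mm'; rewrite big1 // => x _; rewrite big1 // => y _.
rewrite /A; case: eqP => [kx|_]; last first.
  by rewrite trmx0 tens0mx mulmx0 mxtrace0 mulr0.
have [Nxy|] := ltP 0 (N x y); last first.
  by move=> Nxy; rewrite (@le_anti _ _ (N x y) 0) ?Nxy ?chan_ge0 // mul0r.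
rewrite /rho -scalemxAl mxtraceZ max_ent_trace.
suff Bu0 : B y m' *m u x = 0.
  by rewrite mxtrace_mulC /P mulmxA Bu0 mul0mx mxtrace0 mulr0 mulr0.
rewrite mulmxDl mulmx_suml big1 ?add0r.
  by case: ifP => _; rewrite ?mul0mx // mulmxBl mul1mx Su ?subrr.
move=> x' /andP[/eqP kx' Nx'y].
rewrite /P -mulmxA (orth _ _ y) ?mulmx0 //.
apply: contraNneq mm' => xx'; apply/eqP/enum_val_inj.
by rewrite -kx -kx' xx'.
Qed.

End EntangledCode.

(** * Independent uses of a channel, and tensor powers of entangled codes *)

Section Powers.
Variables (R : realType) (X Y : finType) (N : channel R X Y) (n : nat).

Lemma overlap_refl : reflexive (overlap N).
Proof.
move=> x; apply/existsP; apply/not_existsP => N0.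
have := chan_sum1 N x; rewrite big1 => [|y _]; first by move/esym/eqP; rewrite oner_eq0.
apply/eqP; rewrite eq_le chan_ge0 andbT leNgt; apply/negP => Nxy.
by apply: (N0 y); rewrite Nxy.
Qed.

(** A product of nonnegative factors is positive only if all are, and a common output can be chosen
    letter by letter. This is the strong power of the graph. *)
Lemma overlap_powP (x x' : {ffun 'I_n -> X}) :
  reflect (forall j, overlap N (x j) (x' j)) (overlap (chan_pow N n) x x').
Proof.
apply: (iffP existsP) => [[y /andP[xy x'y]] j | xx'].
  apply/existsP; exists (y j).
  have pos z : 0 < chan_pow N n z y -> 0 < N (z j) (y j).
    rewrite !lt_def !chan_ge0 !andbT; apply: contra_neq => z0.
    by rewrite /= /chan_pow_prob (bigD1 j) //= z0 mul0r.
  by rewrite !pos.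
have /fin_all_exists[y y_pos] : forall j, exists y, (0 < N (x j) y) && (0 < N (x' j) y).
  by move=> j; apply/existsP/xx'.
exists (finfun y); rewrite /= /chan_pow_prob !prodr_gt0 // => j _;
  by rewrite ffunE; case/andP: (y_pos j).
Qed.

(** Tensor products of the vectors: distributing products over sums turns inner products and frame
    sums of words into products over the letters. [t0] makes the dimension positive and [k0]
    supplies the default message. *)
Lemma ent_code_pow (K T : finType) (v : X -> T -> R) (kappa : X -> K)
    (k0 : K) (t0 : T) :
  (forall x, \sum_t v x t * v x t = 1) ->
  (forall x x', overlap N x x' -> x != x' -> \sum_t v x t * v x' t = 0) ->
  (forall k s t, \sum_(x | kappa x == k) v x s * v x t = (s == t)%:R) ->
  ent_zero_error_code (chan_pow N n) (#|K| ^ n).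
Proof.
move=> v1 v_orth v_complete.
pose T' := {ffun 'I_n -> T}.
pose w (x : {ffun 'I_n -> X}) (s : T') : R := \prod_j v (x j) (s j).
pose u x : 'cV[R[i]]_#|T'| := \col_s (w x (enum_val s))%:C.
have conj_real (r : R) : Num.conj r%:C = r%:C by exact: conjc_real.
have inner x x' : (u x)^t* *m u x' = (\prod_j \sum_t v (x j) t * v (x' j) t)%:C%:M.
  apply/matrixP => i j; rewrite !ord1 [RHS]mxE eqxx mulr1n bigA_distr_bigA rmorph_sum /=.
  rewrite mxE (big_enum_val (A := T')) /=; apply: eq_bigr => s _.
  by rewrite !mxE conj_real -rmorphM -big_split.
rewrite -[n in (_ ^ n)%N]card_ord -card_ffun.
apply: (@ent_code_of_bases _ _ _ _ _ _ u (fun x => [ffun j => kappa (x j)]) [ffun=> k0]).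
- by apply/card_gt0P; exists [ffun=> t0].
- by move=> x; rewrite inner big1.
- move=> x x' /overlap_powP xx' ne; rewrite inner.
  have [j nej] : exists j, x j != x' j.
    apply/existsP; apply: contraNT ne; rewrite negb_exists => /forallP eqx.
    by apply/eqP/ffunP => j; apply/eqP; rewrite -[_ == _]negbK.
  by rewrite (bigD1 j) //= v_orth // mul0r raddf0.
move=> k; apply/matrixP => a b; rewrite summxE mxE.
transitivity (\prod_j \sum_(x | kappa x == k j)
    v x (enum_val a j) * v x (enum_val b j))%:C.
  rewrite bigA_distr_big_dep rmorph_sum /=.
  apply: eq_big => [x | x _].
    apply/eqP/familyP => [<- j | fam]; first by rewrite unfold_in ffunE.
    by apply/ffunP => j; rewrite ffunE; apply/eqP/(fam j).
  by rewrite mxE big_ord1 !mxE conj_real -rmorphM -big_split.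
under eq_bigr do rewrite v_complete.
have [->|ab] := eqVneq a b; first by rewrite big1 // => j _; rewrite eqxx.
have [j nej] : exists j, enum_val a j != enum_val b j.
  apply/existsP; apply: contraNT ab; rewrite negb_exists => /forallP eqx.
  by apply/eqP/enum_val_inj/ffunP => j; apply/eqP; rewrite -[_ == _]negbK.
by rewrite (bigD1 j) //= (negPf nej) mul0r.
Qed.

End Powers.

(** * Unassisted codes *)

Section ClassicalCodes.
Variables (R : realType) (X Y : finType) (N : channel R X Y).

Lemma zero_error_code_of_separated (K : finType) (f : K -> X) (k0 : K) :
  (forall k k', overlap N (f k) (f k') -> k = k') -> zero_error_code N #|K|.
Proof.
(* The default [k0] serves only outputs that no codeword can produce. *)
move=> sep; pose dec y := odflt k0 [pick k | 0 < N (f k) y].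
exists (fun m => f (enum_val m)), (fun y => enum_rank (dec y)) => m.
apply: big1 => y dec_y; apply/eqP; rewrite eq_le chan_ge0 andbT leNgt.
apply: contra dec_y => Nmy; apply/eqP/enum_val_inj; rewrite enum_rankK /dec.
case: pickP => [k Nky|/(_ (enum_val m))]; last by rewrite Nmy.
by apply: sep; apply/existsP; exists y; rewrite Nky.
Qed.

Lemma zero_error_code_separated (q : nat) :
  zero_error_code N q ->
  exists enc : 'I_q -> X, forall m m', overlap N (enc m) (enc m') -> m = m'.
Proof.
move=> [enc [dec err]]; exists enc => m m' /existsP[y /andP[Nm Nm']].
have dec_y k : 0 < N (enc k) y -> dec y = k.
  move=> Nk; apply/eqP; apply: contraLR Nk => dec_y.
  have /eqP := err k; rewrite psumr_eq0; last by move=> *; apply: chan_ge0.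
  by move=> /allP/(_ y (mem_index_enum _))/implyP/(_ dec_y)/eqP ->; rewrite ltxx.
by rewrite -(dec_y m) // (dec_y m').
Qed.

End ClassicalCodes.

Section ClassicalPowers.
Variables (R : realType) (X Y : finType) (N : channel R X Y) (n : nat).

Lemma zero_error_code_pow (K : finType) (f : K -> X) (k0 : K) :
  (forall k k', overlap N (f k) (f k') -> k = k') ->
  zero_error_code (chan_pow N n) (#|K| ^ n).
Proof.
move=> sep; rewrite -[n in (_ ^ n)%N]card_ord -card_ffun.
apply: (@zero_error_code_of_separated _ _ _ _ _
  (fun k : {ffun 'I_n -> K} => [ffun j => f (k j)]) [ffun=> k0]).
move=> k k' /overlap_powP ov; apply/ffunP => j; apply: sep.
by have := ov j; rewrite !ffunE.
Qed.

(* Haemers' bound: the matrix [\sum_t a x t * b x' t] fits the confusability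
   graph, and its tensor power restricted to a code is diagonal. *)
Lemma haemers_bound (F : fieldType) (T : finType) (a b : X -> T -> F) (q : nat) :
  (forall x, \sum_t a x t * b x t != 0) ->
  (forall x x', ~~ overlap N x x' -> \sum_t a x t * b x' t = 0) ->
  zero_error_code (chan_pow N n) q -> (q <= #|T| ^ n)%N.
Proof.
move=> diag off /zero_error_code_separated[enc sep].
rewrite -[n in (_ ^ n)%N]card_ord -card_ffun.
pose T' := {ffun 'I_n -> T}.
pose A := \matrix_(m < q, s < #|T'|) \prod_j a (enc m j) (enum_val s j).
pose B := \matrix_(s < #|T'|, m < q) \prod_j b (enc m j) (enum_val s j).
have AB m m' : (A *m B) m m' = \prod_j \sum_t a (enc m j) t * b (enc m' j) t.
  rewrite bigA_distr_bigA mxE (big_enum_val (A := T')) /=.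
  by apply: eq_bigr => s _; rewrite !mxE -big_split.
have -> : q = \rank (A *m B); last first.
  by rewrite (leq_trans (mxrankM_maxl _ _)) ?rank_leq_col.
apply/esym/mxrank_unit.
have -> : A *m B = diag_mx (\row_m (A *m B) m m).
  apply/matrixP => m m'; rewrite [RHS]mxE [X in X *+ _]mxE.
  have [->|ne] := eqVneq m m'; first by rewrite mulr1n.
  rewrite mulr0n AB.
  have [j nov] : exists j, ~~ overlap N (enc m j) (enc m' j).
    apply/existsP; apply: contraNT ne; rewrite negb_exists => /forallP ov.
    by apply/eqP/sep/overlap_powP => j; rewrite -[overlap _ _ _]negbK.
  by rewrite (bigD1 j) //= off // mul0r.
rewrite unitmxE det_diag unitfE; apply/prodf_neq0 => m _.
by rewrite mxE AB; apply/prodf_neq0 => j _; apply: diag.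
Qed.

End ClassicalPowers.

(** * The root system E7 and its nine orthogonal frames *)

(* The 63 roots of E7 up to sign, scaled to have squared norm 4: twice the unit
   vectors, and the signed words of weight 4 of the [7,3] simplex code.  Each
   block of seven consecutive roots is an orthogonal frame. *)
Definition e7_roots : seq (seq int) :=
 [:: [:: 2; 0; 0; 0; 0; 0; 0]; [:: 0; 2; 0; 0; 0; 0; 0];
     [:: 0; 0; 2; 0; 0; 0; 0]; [:: 0; 0; 0; 2; 0; 0; 0];
     [:: 0; 0; 0; 0; 2; 0; 0]; [:: 0; 0; 0; 0; 0; 2; 0];
     [:: 0; 0; 0; 0; 0; 0; 2];
     [:: 0; 0; 0; 1; 1; 1; 1]; [:: 0; 1; 1; 0; 0; 1; -1];
     [:: 0; 1; -1; 1; -1; 0; 0]; [:: 1; 0; 1; 0; -1; 0; 1];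
     [:: 1; 0; -1; -1; 0; 1; 0]; [:: 1; 1; 0; 0; 1; -1; 0];
     [:: 1; -1; 0; 1; 0; 0; -1];
     [:: 0; 0; 0; 1; 1; 1; -1]; [:: 0; 1; 1; 0; 0; -1; -1];
     [:: 0; 1; -1; -1; 1; 0; 0]; [:: 1; 0; 1; 0; 1; 0; 1];
     [:: 1; 0; -1; 1; 0; -1; 0]; [:: 1; 1; 0; 0; -1; 1; 0];
     [:: 1; -1; 0; -1; 0; 0; -1];
     [:: 0; 0; 0; 1; 1; -1; 1]; [:: 0; 1; -1; 0; 0; 1; 1];
     [:: 0; 1; 1; -1; 1; 0; 0]; [:: 1; 0; -1; 0; 1; 0; -1];
     [:: 1; 0; 1; 1; 0; 1; 0]; [:: 1; 1; 0; 0; -1; -1; 0];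
     [:: 1; -1; 0; -1; 0; 0; 1];
     [:: 0; 0; 0; 1; 1; -1; -1]; [:: 0; 1; -1; 0; 0; -1; 1];
     [:: 0; 1; 1; 1; -1; 0; 0]; [:: 1; 0; -1; 0; -1; 0; -1];
     [:: 1; 0; 1; -1; 0; -1; 0]; [:: 1; 1; 0; 0; 1; 1; 0];
     [:: 1; -1; 0; 1; 0; 0; 1];
     [:: 0; 0; 0; 1; -1; 1; 1]; [:: 0; 1; 1; 0; 0; -1; 1];
     [:: 0; 1; -1; -1; -1; 0; 0]; [:: 1; 0; -1; 0; 1; 0; 1];
     [:: 1; 0; 1; -1; 0; 1; 0]; [:: 1; -1; 0; 0; -1; -1; 0];
     [:: 1; 1; 0; 1; 0; 0; -1];
     [:: 0; 0; 0; 1; -1; 1; -1]; [:: 0; 1; 1; 0; 0; 1; 1];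
     [:: 0; 1; -1; 1; 1; 0; 0]; [:: 1; 0; -1; 0; -1; 0; 1];
     [:: 1; 0; 1; 1; 0; -1; 0]; [:: 1; -1; 0; 0; 1; 1; 0];
     [:: 1; 1; 0; -1; 0; 0; -1];
     [:: 0; 0; 0; 1; -1; -1; 1]; [:: 0; 1; -1; 0; 0; -1; -1];
     [:: 0; 1; 1; 1; 1; 0; 0]; [:: 1; 0; 1; 0; -1; 0; -1];
     [:: 1; 0; -1; 1; 0; 1; 0]; [:: 1; -1; 0; 0; 1; -1; 0];
     [:: 1; 1; 0; -1; 0; 0; 1];
     [:: 0; 0; 0; 1; -1; -1; -1]; [:: 0; 1; -1; 0; 0; 1; -1];
     [:: 0; 1; 1; -1; -1; 0; 0]; [:: 1; 0; 1; 0; 1; 0; -1];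
     [:: 1; 0; -1; -1; 0; -1; 0]; [:: 1; -1; 0; 0; -1; 1; 0];
     [:: 1; 1; 0; 1; 0; 0; 1]].

(* The symplectic space is E7 / 2 E7 modulo its radical, with the form half the
   inner product modulo 2; its i-th coordinate is the product with the i-th of these roots. *)
Definition e7_basis : seq (seq int) :=
 [:: [:: 2; 0; 0; 0; 0; 0; 0]; [:: 0; 2; 0; 0; 0; 0; 0];
     [:: 0; 0; 0; 2; 0; 0; 0]; [:: 1; 0; 1; 0; 1; 0; 1];
     [:: 0; 1; 1; 0; 0; 1; -1]; [:: 0; 0; 0; 1; 1; -1; -1]].

(** A recursion on lists, so that the checks on the table run by computation; [int_dotE] gives the
    sum used in proofs. *)
Definition int_dot (r s : seq int) : int :=
  foldr (fun p acc => p.1 * p.2 + acc) 0 (zip r s).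

Lemma int_dotE (n : nat) (r s : seq int) : size r = n -> size s = n ->
  int_dot r s = \sum_(t < n) nth 0 r t * nth 0 s t.
Proof.
elim: n r s => [|n IHn] [|x r] [|y s] //=; rewrite ?big_ord0 // => -[sr] [ss].
by rewrite big_ord_recl /= -(IHn r s).
Qed.

(** Products of these roots lie in {0, 2, -2, 4, -4}, so half of one is odd exactly when its
    absolute value is 2. *)
Definition e7_codes : seq (seq bool) :=
  [seq [seq `|int_dot r b|%N == 2 | b <- e7_basis] | r <- e7_roots].

Arguments e7_roots : simpl never.
Arguments e7_codes : simpl never.

(** The form [sigma] on bits. The roots of [e7_basis] are paired in the same way, [i] with [i + 3],
    and are otherwise orthogonal: a symplectic basis. *)
Definition bit_form (s t : seq bool) : bool :=
  let p i j := nth false s i && nth false t j in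
  p 0 3 (+) p 3 0 (+) p 1 4 (+) p 4 1 (+) p 2 5 (+) p 5 2.

(** * Finite checks on the table of roots *)

Lemma e7_sizes : all (fun r => size r == 7%N) e7_roots.
Proof. by vm_compute. Qed.

Lemma e7_codes_surj (b0 b1 b2 b3 b4 b5 : bool) :
  [|| b0, b1, b2, b3, b4 | b5] -> [:: b0; b1; b2; b3; b4; b5] \in e7_codes.
Proof. by case: b0 b1 b2 b3 b4 b5 => [] [] [] [] [] [] //; vm_compute. Qed.

Lemma e7_orthogonal :
  all (fun i => all (fun j => [|| i == j,
      bit_form (nth [::] e7_codes i) (nth [::] e7_codes j) |
      int_dot (nth [::] e7_roots i) (nth [::] e7_roots j) == 0])
    (iota 0 63)) (iota 0 63).
Proof. by vm_compute. Qed.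

Lemma e7_norm : all (fun r => int_dot r r == 4) e7_roots.
Proof. by vm_compute. Qed.

Lemma e7_frames_isotropic :
  all (fun i => all (fun j => (i %/ 7 == j %/ 7)%N ==>
      ~~ bit_form (nth [::] e7_codes i) (nth [::] e7_codes j))
    (iota 0 63)) (iota 0 63).
Proof. by vm_compute. Qed.

(** A frame is twice an orthogonal matrix, so its columns are orthogonal too: the resolution of the
    identity required of Alice's measurements. *)
Lemma e7_frames_complete :
  all (fun k => all (fun s => all (fun t =>
      let c x := [seq nth 0 (nth [::] e7_roots (7 * k + i)) x | i <- iota 0 7] in
      int_dot (c s) (c t) == (if s == t then 4 else 0))
    (iota 0 7)) (iota 0 7)) (iota 0 9).
Proof. by vm_compute. Qed.

(* As positions in [e7_codes]. *)
Definition anticommuting7 : seq nat := [:: 0; 10; 17; 25; 34; 46; 62]%N.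

Lemma anticommuting7P :
  all (fun k => all (fun l => (k == l) ||
      bit_form (nth [::] e7_codes (nth 0%N anticommuting7 k))
               (nth [::] e7_codes (nth 0%N anticommuting7 l)))
    (iota 0 7)) (iota 0 7).
Proof. by vm_compute. Qed.

(** * Coordinates of the symplectic space *)

Section Bits.
Local Notation V := 'cV['F_2]_(3 + 3).

Definition vbits (u : V) : seq bool :=
  mkseq (fun i => u (inord i : 'I_6) 0 != 0) 6.

Lemma vbits_inj : injective vbits.
Proof.
move=> u v uv; apply/colP => i.
have i6 : (i < 6)%N := ltn_ord i.
have := congr1 (fun s => nth false s i) uv; rewrite !nth_mkseq //.
have -> : (inord i : 'I_6) = i by apply: val_inj; rewrite /= inordK.
move: (u i 0) (v i 0).
by case=> [[|[|//]] ?] [[|[|//]] ?] //= _; apply: val_inj.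
Qed.

Lemma F2_natrb (x : 'F_2) : x = (x != 0)%:R.
Proof. by case: x => [[|[|//]] ?]; apply: val_inj. Qed.

Lemma F2_addb (a b : bool) : (a (+) b)%:R = a%:R + b%:R :> 'F_2.
Proof. by case: a b => [] []; apply: val_inj. Qed.

Lemma F2_oppr (x : 'F_2) : - x = x.
Proof. by apply: oppr_pchar2; rewrite ?pchar_Fp. Qed.

Lemma sigmaE (u v : V) (e := fun i => inord i : 'I_6) : sigma u v =
  \sum_(i < 3) (u (e i) 0 * v (e (3 + i)%N) 0 + u (e (3 + i)%N) 0 * v (e i) 0).
Proof.
rewrite /sigma /symp_mx -[in LHS](vsubmxK u) -[in LHS](vsubmxK v) tr_col_mx.
rewrite mul_row_block mul_row_col !mulmx0 addr0 add0r mulmxN !mulmx1 mulNmx.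
rewrite big_split /= [RHS]addrC [LHS]mxE [X in X + _]mxE F2_oppr.
have le (i : 'I_3) : lshift 3 i = e i.
  by apply: val_inj; rewrite /= inordK // (leq_trans (ltn_ord i)).
have re (i : 'I_3) : rshift 3 i = e (3 + i)%N.
  by apply: val_inj; rewrite /= inordK // ltn_add2l.
by rewrite !mxE; congr (_ + _); apply: eq_bigr => i _; rewrite !mxE le re.
Qed.

Lemma sigma_bits (u v : V) : sigma u v = (bit_form (vbits u) (vbits v))%:R.
Proof.
rewrite sigmaE !big_ord_recl big_ord0 addr0 /bit_form !F2_addb !nth_mkseq //.
by rewrite -!mulnb !natrM -!F2_natrb !addrA.
Qed.

Lemma sigma_eq0 (u v : V) : (sigma u v == 0) = ~~ bit_form (vbits u) (vbits v).
Proof. by rewrite sigma_bits; case: bit_form. Qed.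

End Bits.

(** * Identification of the vertices with positions in the table *)

Section Positions.

Lemma vbits_e7 (u : sp6) : vbits (val u) \in e7_codes.
Proof.
apply: e7_codes_surj; have := valP u; apply: contraNT => u0; apply/eqP/vbits_inj.
move: u0; rewrite /vbits /mkseq /= !mxE eqxx.
by do 6! case: eqP => //=.
Qed.

(* Opaque, to keep conversion from unfolding the table. *)
Lemma e7_pos_sig (u : sp6) :
  {p : 'I_63 | nth [::] e7_codes p = vbits (val u)}.
Proof.
have lt63 : (index (vbits (val u)) e7_codes < 63)%N.
  by rewrite (_ : 63%N = size e7_codes) ?index_mem ?vbits_e7.
by exists (Ordinal lt63); apply: nth_index (vbits_e7 u).
Qed.

Definition e7_pos (u : sp6) : 'I_63 := sval (e7_pos_sig u).

Lemma e7_posE (u : sp6) : nth [::] e7_codes (e7_pos u) = vbits (val u).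
Proof. exact: svalP (e7_pos_sig u). Qed.

(** A code determines its vector, and there are 2^6 - 1 = 63 of each. *)
Lemma e7_pos_bij : bijective e7_pos.
Proof.
apply: inj_card_bij => [u v uv|].
  by apply/val_inj/vbits_inj; rewrite -!e7_posE uv.
by rewrite card_ord card_sig cardC1 card_mx card_Fp.
Qed.

Lemma allallP (p : rel nat) (m n i j : nat) :
  all (fun i => all (p i) (iota 0 n)) (iota 0 m) -> (i < m)%N -> (j < n)%N -> p i j.
Proof.
move=> /allP pp im jn.
have := pp i; rewrite mem_iota => /(_ im)/allP/(_ j).
by rewrite mem_iota => /(_ jn).
Qed.

Definition sp6_root (u : sp6) : seq int := nth [::] e7_roots (e7_pos u).

Definition sp6_frame (u : sp6) : 'I_9 := inord (e7_pos u %/ 7).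

Lemma sp6_frame_val (u : sp6) : sp6_frame u = (e7_pos u %/ 7)%N :> nat.
Proof. by rewrite inordK // ltn_divLR // (ltn_ord (e7_pos u)). Qed.

Lemma sp6_frame_isotropic (u v : sp6) :
  sp6_frame u = sp6_frame v -> sigma (val u) (val v) = 0.
Proof.
move=> /(congr1 (@nat_of_ord 9)).
rewrite sp6_frame_val.
rewrite sp6_frame_val => /eqP uv.
apply/eqP; rewrite sigma_eq0 -!e7_posE.
have := allallP e7_frames_isotropic (ltn_ord (e7_pos u)) (ltn_ord (e7_pos v)).
by rewrite uv.
Qed.

Lemma sp6_root_size (u : sp6) : size (sp6_root u) = 7%N.
Proof. by apply/eqP/(allP e7_sizes)/mem_nth/ltn_ord. Qed.

Lemma sp6_root_norm (u : sp6) : int_dot (sp6_root u) (sp6_root u) = 4.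
Proof. by apply/eqP/(allP e7_norm)/mem_nth/ltn_ord. Qed.

Lemma sp6_root_orthogonal (u v : sp6) : u != v -> sigma (val u) (val v) = 0 ->
  int_dot (sp6_root u) (sp6_root v) = 0.
Proof.
move=> uv /eqP; rewrite sigma_eq0 -!e7_posE => /negPf s0.
have := allallP e7_orthogonal (ltn_ord (e7_pos u)) (ltn_ord (e7_pos v)).
by rewrite s0 (inj_eq val_inj) (inj_eq (bij_inj e7_pos_bij)) (negPf uv) => /eqP.
Qed.

Lemma sp6_frame_complete (k : 'I_9) (s t : 'I_7) :
  \sum_(u | sp6_frame u == k) nth 0 (sp6_root u) s * nth 0 (sp6_root u) t
    = if s == t then 4 else 0 :> int.
Proof.
have [g posK gK] := e7_pos_bij.
pose h (i : 'I_7) := g (inord (7 * k + i)).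
have pos_h i : e7_pos (h i) = (7 * k + i)%N :> nat.
  rewrite gK inordK // (leq_trans (_ : _ < 7 * k + 7)%N) ?ltn_add2l //.
  by rewrite addnC -mulnS (leq_mul2l 7 _ 9) ltn_ord orbT.
(* Frame [k] occupies the positions 7k to 7k + 6, so the remainder modulo 7 inverts [h]. *)
rewrite (reindex h) /=; last first.
  exists (fun u => inord (e7_pos u %% 7)) => [i _ | u]; last rewrite inE => /eqP uk.
  - by apply: val_inj; rewrite pos_h /= inordK ?ltn_pmod // mulnC modnMDl modn_small.
  - apply: (bij_inj e7_pos_bij); apply: ord_inj; rewrite pos_h inordK ?ltn_pmod //.
    by rewrite -uk sp6_frame_val mulnC -divn_eq.
under eq_bigl => i.
  rewrite -(inj_eq val_inj) /= sp6_frame_val pos_h mulnC divnMDl // divn_small // addn0.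
  rewrite eqxx; over.
have := allP e7_frames_complete k; rewrite mem_iota => /(_ (ltn_ord k)) fk.
have /eqP := allallP fk (ltn_ord s) (ltn_ord t).
rewrite (int_dotE (n := 7)) // (inj_eq val_inj) => <-.
apply: eq_bigr => i _; rewrite /sp6_root pos_h.
by rewrite !(nth_map 0%N) ?size_iota // nth_iota.
Qed.

Lemma sp6_anticommuting :
  exists f : 'I_7 -> sp6, forall k l, sigma (val (f k)) (val (f l)) = 0 -> k = l.
Proof.
have [g _ gK] := e7_pos_bij.
exists (fun k => g (inord (nth 0%N anticommuting7 k))) => k l /eqP.
have small i : (nth 0%N anticommuting7 i < 63)%N.
  by do 7! [case: i => [|i] //]; case: i.
rewrite sigma_eq0 -!e7_posE !gK !inordK // => /negPf s0.
have := allallP anticommuting7P (ltn_ord k) (ltn_ord l).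
by rewrite s0 orbF => /eqP/val_inj.
Qed.

End Positions.

(** * The capacities *)

Lemma cvg_log_expn (R : realType) (b : R) (k : nat) : (0 < k)%N ->
  n%:R^-1 * logb b (k ^ n)%:R @[n --> \oo] --> logb b k%:R.
Proof.
move=> k0; apply: cvg_near_cst; near=> n.
(* The sequence is constant only from 1 on: at 0 the inverse is 0 by convention. *)
have n0 : (0 < n)%N by near: n; exists 1%N.
rewrite /logb natrX lnXn ?ltr0n // -[ln _ *+ n]mulr_natl -mulrA mulKf //.
by rewrite pnatr_eq0 -lt0n.
Unshelve. all: by end_near.
Qed.

Section Sp6Channel.
Variables (R : realType) (Y : finType) (N : channel R sp6 Y).
Variable graphN : edge (s := confusability_graph N) =2 edge (s := sp6).

Lemma sp6_overlap (u v : sp6) : overlap N u v = (sigma (val u) (val v) == 0).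
Proof.
have [<-|uv] := eqVneq u v.
  by rewrite overlap_refl (sp6_frame_isotropic erefl) eqxx.
by have := graphN u v; rewrite /= /confusable /sp6_edge /= uv.
Qed.

Lemma sp6_zero_error_largest (n : nat) :
  is_largest (zero_error_code (chan_pow N n)) (7 ^ n).
Proof.
split.
  have [f f_sep] := sp6_anticommuting.
  rewrite -[7%N]card_ord; apply: (zero_error_code_pow n (f := f) ord0) => k l.
  by rewrite sp6_overlap => /eqP/f_sep.
move=> q codeq.
(* The matrix 1 + sigma(u, v) factors through dimension 1 + 6 = 7; over the two-element field it
   vanishes exactly when sigma is 1, that is, off [overlap]. *)
pose a (u : sp6) t := row_mx 1%:M ((val u)^T *m symp_mx) 0 t.
pose b (u : sp6) t := col_mx 1%:M (val u) t 0.
have ab u v : \sum_t a u t * b v t = 1 + sigma (val u) (val v).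
  transitivity ((row_mx 1%:M ((val u)^T *m symp_mx) *m col_mx 1%:M (val v)) 0 0).
    by rewrite mxE.
  by rewrite mul_row_col mul1mx mxE [X in X + _]mxE.
have := @haemers_bound _ _ _ N n _ _ a b q; rewrite card_ord; apply => //.
- by move=> u; rewrite ab (sp6_frame_isotropic erefl) addr0 oner_eq0.
- move=> u v; rewrite sp6_overlap ab sigma_bits.
  by case: bit_form => //= _; apply: val_inj.
Qed.

Lemma sp6_ent_zero_error_largest (n : nat) :
  is_largest (ent_zero_error_code (chan_pow N n)) (9 ^ n).
Proof.
split; last first.
  move=> q; rewrite -[9%N]card_ord -[n in (_ ^ n)%N]card_ord -card_ffun.
  apply: (ent_code_le_clique_cover
    (kappa := fun x : {ffun 'I_n -> sp6} => [ffun j => sp6_frame (x j)])).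
  move=> x x' /ffunP xx'; apply/overlap_powP => j; rewrite sp6_overlap.
  by rewrite sp6_frame_isotropic //; have := xx' j; rewrite !ffunE.
(* The roots have squared norm 4, so halving makes them unit vectors. *)
pose v (u : sp6) (t : 'I_7) : R := (nth 0 (sp6_root u) t)%:~R / 2.
have inner u u' : \sum_t v u t * v u' t = (int_dot (sp6_root u) (sp6_root u'))%:~R / 4.
  rewrite (int_dotE (sp6_root_size u) (sp6_root_size u')) rmorph_sum mulr_suml.
  by apply: eq_bigr => t _; rewrite /v rmorphM mulrACA -invfM -natrM.
rewrite -[9%N]card_ord.
apply: (ent_code_pow n (v := v) (kappa := sp6_frame) ord0 ord0).
- by move=> u; rewrite inner sp6_root_norm divff // pnatr_eq0.
- move=> u u'; rewrite sp6_overlap inner => /eqP s0 uu'.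
  by rewrite sp6_root_orthogonal // mul0r.
move=> k s t.
transitivity ((\sum_(u | sp6_frame u == k)
    nth 0 (sp6_root u) s * nth 0 (sp6_root u) t)%:~R / 4 : R).
  rewrite rmorph_sum mulr_suml; apply: eq_bigr => u _.
  by rewrite /v rmorphM mulrACA -invfM -natrM.
rewrite sp6_frame_complete; case: eqP => _; last by rewrite mul0r.
by rewrite divff // pnatr_eq0.
Qed.

End Sp6Channel.

Theorem theorem8 (R : realType) (b : R) (hb : 1 < b) :
  is_graph_C0 b sp6 (logb b 7) /\ is_graph_C0E b sp6 (logb b 9).
Proof.
split=> Y N graphN.
  exists (fun n => 7 ^ n)%N; split; last exact: cvg_log_expn.
  by move=> n; apply: sp6_zero_error_largest.
exists (fun n => 9 ^ n)%N; split; last exact: cvg_log_expn.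
by move=> n; apply: sp6_ent_zero_error_largest.
Qed.
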